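(* Let $n \ge 2$. The mean statistics of the excedance number and the weak excedance number on $\mathfrak{S}_n$ decompose into irreducible characters as \[ \overline{\mathrm{exc}} = \frac{n-1}{2}\chi^{(n)} - \frac{1}{2}\chi^{(n-1,1)} \qquad\text{and}\qquad \overline{\mathrm{wexc}} = \frac{n+1}{2}\chi^{(n)} + \frac{1}{2}\chi^{(n-1,1)}. \]
   Context: For $\pi \in \mathfrak{S}_n$, an excedance of $\pi$ is an index $i \in [n]$ with $\pi(i) > i$, and a weak excedance is an index $i$ with $\pi(i) \ge i$; $\mathrm{exc}(\pi)$ and $\mathrm{wexc}(\pi)$ denote their respective numbers. For a function $\mathfrak{s}:\mathfrak{S}_n\to\mathbb{R}$, the mean statistic $\overline{\mathfrak{s}}$ is the class function whose value on a permutation of cycle type $\lambda$ is $\frac{1}{|C_\lambda|}\sum_{\pi\in C_\lambda}\mathfrak{s}(\pi)$, where $C_\lambda$ is the conjugacy class of permutations of cycle type $\lambda$. $\chi^\lambda$ denotes the irreducible character of $\mathfrak{S}_n$ indexed by the partition $\lambda \vdash n$ in the standard way; $\chi^{(n)}$ is the trivial character and $\chi^{(n-1,1)}(\pi)$ equals the number of fixed points of $\pi$ minus one. *)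

(* Defs.v *)
From mathcomp Require Import all_boot all_order all_algebra all_fingroup.
From mathcomp Require Import all_solvable all_field all_character.

Set Implicit Arguments.
Unset Strict Implicit.
Unset Printing Implicit Defensive.

Import Order.TTheory GroupScope GRing.Theory Num.Theory.
Local Open Scope ring_scope.

Section Statistics.

Variable n : nat.

Definition exc (p : 'S_n) : nat := #|[set i : 'I_n | (i < p i)%N]|.

Definition wexc (p : 'S_n) : nat := #|[set i : 'I_n | (i <= p i)%N]|.

(* The class x ^: [set: 'S_n] consists of the permutations with the same
   cycle type as x. *)
Definition mean_fun (s : 'S_n -> algC) (x : 'S_n) : algC :=
  #|x ^: [set: 'S_n]|%:R^-1 * \sum_(y in x ^: [set: 'S_n]) s y.

Fact mean_is_class_fun (s : 'S_n -> algC) :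
  is_class_fun <<[set: 'S_n]>> (finfun (mean_fun s)).
Proof.
rewrite genGid; apply: intro_class_fun => [x y _ _|x]; last by rewrite inE.
by rewrite /mean_fun classGidl ?inE.
Qed.

Definition mean (s : 'S_n -> algC) : 'CF([set: 'S_n]) :=
  Cfun 0 (mean_is_class_fun s).

End Statistics.

(* A partition of n is given by the sequence lam of its parts, in
   nonincreasing order.  Its Young diagram is filled with 0, ..., n.-1 row
   after row, so that k lies in row reshape_index lam k and column
   reshape_offset lam k. *)
Section Specht.

Variables (n : nat) (lam : seq nat).

Definition row_stab : {set 'S_n} :=
  [set p : 'S_n | [forall k : 'I_n, reshape_index lam (p k) == reshape_index lam k]].

Definition col_stab : {set 'S_n} :=
  [set q : 'S_n | [forall k : 'I_n, reshape_offset lam (q k) == reshape_offset lam k]].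

(* The Young symmetrizer, as a row vector in the basis of the group algebra
   indexed by 'S_n.  In MathComp q * p applies q first, so q * p is the usual
   product "p after q", with p in the row stabilizer and q in the column
   stabilizer. *)
Definition young_symmetrizer : 'rV[algC]_#|[set: 'S_n]| :=
  \sum_(p in row_stab) \sum_(q in col_stab)
    (-1) ^+ odd_perm q *: delta_mx 0 (gring_index [set: 'S_n] (q * p)%g).

(* The Specht module: the submodule of the regular representation generated
   by the Young symmetrizer.  MathComp representations act on the right, and
   with products of permutations read as above this is the usual left ideal
   C['S_n] * young_symmetrizer. *)
Definition specht_repr :=
  submod_repr
    (cyclic_mx_module (regular_repr algC [set: 'S_n]) young_symmetrizer).

Definition specht_char : 'CF([set: 'S_n]) := cfRepr specht_repr.

End Specht.

(* Main.v *)
(* Conjugating by the order-reversing permutation turns excedances into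
   anti-excedances, so twice the mean of exc on a class is n minus the number
   of fixed points; wexc is exc plus the number of fixed points.  The Young
   symmetrizer of (n) is the sum of the group.  That of (n-1,1) is the last of
   the vectors v_j = sum of {h | h(last) = j} - sum of {h | h(0) = j}; these are
   permuted by 'S_n and satisfy the single relation sum_j v_j = 0, so the Specht
   module has the permutation character minus one. *)
Require Import Defs.
From mathcomp Require Import all_boot all_order all_algebra all_fingroup.
From mathcomp Require Import all_solvable all_field all_character.
From mathcomp Require Import ring.

Set Implicit Arguments.
Unset Strict Implicit.
Unset Printing Implicit Defensive.

Import Order.TTheory GroupScope GRing.Theory Num.Theory.
Local Open Scope ring_scope.

(** * Traces on submodules spanned by permuted vectors *)

(* Q is the idempotent of the row space of coordinates obtained by factoring
   through U; it lets one compute traces on U from a spanning family V that need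
   not be free. *)
Lemma mxtrace_submod (F : fieldType) (gT : finGroupType) (G : {group gT})
    (n m : nat) (rG : mx_representation F G n) (U : 'M[F]_n) (V : 'M[F]_(m, n))
    (Umod : mxmodule rG U) (P : 'M[F]_m) (x : gT) :
    x \in G -> (U :=: V)%MS -> V *m rG x = P *m V ->
  exists Q : 'M[F]_m,
    [/\ Q *m V = V, forall c : 'rV_m, c *m V = 0 -> c *m Q = 0
      & \tr (submod_repr Umod x) = \tr (P *m Q)].
Proof.
move=> Gx defU VxP.
(* [E] is a basis of [U]; [C] writes it in terms of [V], and [H] writes [V] in terms of it. Then [Q]
   is [H *m C]. *)
have [E defE] : {E | E = val_submod (1%:M : 'M_(\rank U))}.
  by exists (val_submod 1%:M).
have [C CV] : exists C, E = C *m V.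
  by apply/submxP; rewrite defE -defU val_submodP.
have [H HE] : exists H, V = H *m E.
  by exists (in_submod U V); rewrite defE -val_submodE in_submodK ?defU.
exists (H *m C); split=> [|c cV0|]; first by rewrite -mulmxA -CV -HE.
  rewrite mulmxA; suff -> : c *m H = 0 by rewrite mul0mx.
  by apply: val_submod_inj; rewrite val_submodE -defE -mulmxA -HE linear0.
(* By cyclicity the trace is that of [C *m P *m H], which is the matrix of the action of [x] on [U]
   in the basis [E]. *)
rewrite mulmxA (mxtrace_mulC (P *m H)) mulmxA; congr mxtrace.
apply: val_submod_inj; rewrite -[LHS]/(val_submod (submod_mx Umod x)).
rewrite -[submod_mx Umod x]mul1mx val_submodJ // -defE [LHS](congr1 (mulmx^~ _) CV).
by rewrite -mulmxA VxP [RHS]val_submodE -defE -!mulmxA -HE.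
Qed.

(** The row space of [V] is stable, so it contains the module generated by one row; transitivity
    moves that row to every other one. *)
Lemma cyclic_mx_row (F : fieldType) (gT : finGroupType) (G : {group gT})
    (n m : nat) (rG : mx_representation F G n) (V : 'M[F]_(m, n))
    (s : gT -> 'S_m) (i0 : 'I_m) :
    {in G, forall x, V *m rG x = perm_mx (s x) *m V} ->
    (forall i, exists2 x, x \in G & s x i0 = i) ->
  (cyclic_mx rG (row i0 V) :=: V)%MS.
Proof.
move=> Vs trans; apply/eqmxP/andP; split.
  apply: cyclic_mx_sub (row_sub _ _).
  by apply/mxmoduleP=> x Gx; rewrite Vs ?submxMl.
apply/row_subP=> i; have [x Gx <-] := trans i.
have -> : row (s x i0) V = row i0 V *m rG x.
  by rewrite -row_mul Vs // -row_permE; apply/rowP=> j; rewrite !mxE.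
by rewrite mxmodule_trans ?cyclic_mx_module ?cyclic_mx_id.
Qed.

(** Row [i] stands for the group algebra element with coefficients [w i]. The coefficient at [g]
    after right multiplication by [x] is the old one at [g * x^-1], so the hypothesis says that row
    [i] becomes row [s i]. *)
Lemma mulmx_regular (F : fieldType) (gT : finGroupType) (G : {group gT})
    (m : nat) (w : 'I_m -> gT -> F) (s : 'S_m) (x : gT) :
    x \in G -> (forall i y, w (s i) (y * x)%g = w i y) ->
  (\matrix_(i, k) w i (enum_val k)) *m regular_repr F G x
    = perm_mx s *m \matrix_(i, k) w i (enum_val k) :> 'M[F]_(m, #|G|).
Proof.
move=> Gx ws; rewrite -row_permE; apply/matrixP=> i k; rewrite !mxE.
have Gkx : (enum_val k * x^-1)%g \in G by rewrite groupM ?groupV ?enum_valP.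
rewrite (bigD1 (gring_index G (enum_val k * x^-1))) //= !mxE gring_indexK //.
rewrite mulgKV gring_valK !eqxx mulr1 big1 ?addr0 => [|j ne_j].
  by rewrite -{2}(mulgKV x (enum_val k)) ws.
rewrite !mxE eqxx /=; case: eqP => [kj|_]; last by rewrite mulr0.
by case/eqP: ne_j; rewrite kj gring_indexK ?groupM ?enum_valP // mulgK gring_valK.
Qed.

(** * Specht characters of the shapes (n) and (n-1,1) *)

(** For a given [q], the equation [q * p = g] has the single solution [p = q^-1 * g]. *)
Lemma young_symmetrizerE (n : nat) (lam : seq nat) (k : 'I_#|[set: 'S_n]|) :
  young_symmetrizer n lam 0 k =
    \sum_(q in col_stab n lam)
      (-1) ^+ odd_perm q * (q^-1 * enum_val k \in row_stab n lam)%g%:R.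
Proof.
rewrite /young_symmetrizer exchange_big /= summxE; apply: eq_bigr => q _.
rewrite summxE; set p0 := (q^-1 * enum_val k)%g.
have entry (p : 'S_n) :
    ((-1) ^+ odd_perm q *: delta_mx 0 (gring_index [set: 'S_n] (q * p)%g)
       : 'rV[algC]_ _) 0 k = (-1) ^+ odd_perm q * (p == p0)%:R.
  rewrite !mxE eqxx /=; congr (_ * _%:R); rewrite -(inj_eq enum_val_inj).
  by rewrite gring_indexK ?inE // eq_sym -(can_eq (mulKg q) p) mulKVg.
rewrite (eq_bigr _ (fun p _ => entry p)) -mulr_sumr; congr (_ * _).
have [Rp0|nRp0] := boolP (p0 \in _); last first.
  by rewrite big1 // => p Rp; case: eqP Rp nRp0 => // -> ->.
by rewrite (bigD1 p0) //= eqxx big1 ?addr0 // => p /andP[_ /negbTE->].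
Qed.

Lemma specht_char_row (n : nat) (x : 'S_n) : specht_char n [:: n] x = 1.
Proof.
rewrite cfunE inE mulr1n /specht_repr.
move: (cyclic_mx_module _ _); set U := cyclic_mx _ _ => Umod.
pose w (i : 'I_1) (y : 'S_n) : algC := 1.
pose V : 'M[algC]_(1, #|[set: 'S_n]|) := \matrix_(i, k) w i (enum_val k).
have Vs y : y \in [set: 'S_n] ->
    V *m regular_repr algC [set: 'S_n] y = perm_mx 1 *m V.
  by move=> Gy; apply: mulmx_regular.
have row_stabT p : p \in row_stab n [:: n].
  by rewrite inE; apply/forallP=> k; rewrite /reshape_index /= !subn_eq0 !ltn_ord.
have col_stab1 q : (q \in col_stab n [:: n]) = (q == 1%g).
  apply/idP/eqP => [|->]; rewrite inE; last first.
    by apply/forallP=> k; rewrite perm1.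
  move=> /forallP qP; apply/permP=> k; rewrite perm1; apply/val_inj/eqP.
  have := qP k; rewrite /reshape_offset /reshape_index /= !subn_eq0 !ltn_ord /=.
  by rewrite !subn0.
have eV : young_symmetrizer n [:: n] = row ord0 V.
  apply/rowP=> k; rewrite young_symmetrizerE !mxE (big_pred1 1%g) //.
  by rewrite row_stabT odd_perm1 mulr1.
have defU : (U :=: V)%MS.
  rewrite /U eV; apply: (cyclic_mx_row (s := fun=> 1%g)) => // i.
  by exists 1%g; rewrite ?inE // perm1 (ord1 i).
have [//||Q [QV _ ->]] := mxtrace_submod Umod _ defU (Vs x _); rewrite ?inE //.
(* All entries of [V] are 1, so [Q *m V = V] forces the 1 by 1 matrix [Q] to be 1. *)
have := congr1 (fun A : 'M_(_, _) => A ord0 (gring_index _ 1%g)) QV.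
rewrite !mxE big_ord1 !mxE mulr1 perm_mx1 mul1mx => Q00.
by rewrite /mxtrace big_ord1.
Qed.

(** The second row has [ord_max] as its only cell. *)
Lemma row_stab_hook (m : nat) (p : 'S_m.+2) :
  (p \in row_stab m.+2 [:: m.+1; 1%N]) = (p ord_max == ord_max).
Proof.
have idx (k : 'I_m.+2) : reshape_index [:: m.+1; 1%N] k = (k == ord_max) :> nat.
  rewrite /reshape_index /= subn_eq0 -val_eqE /=.
  have := ltn_ord k; rewrite ltnS leq_eqVlt => /orP[/eqP->|lt_k].
    by rewrite ltnn eqxx subSnn.
  by rewrite lt_k ltn_eqF.
rewrite inE; apply/forallP/idP => [/(_ ord_max)|/eqP pmax k].
  by rewrite !idx eqxx; case: (p _ == _).
by rewrite !idx -{1}pmax (inj_eq perm_inj).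
Qed.

(** Column 0 consists of [ord0] and [ord_max]; every other column is a single cell, hence fixed. *)
Lemma col_stab_hook (m : nat) :
  col_stab m.+2 [:: m.+1; 1%N] = [set 1%g; tperm ord0 ord_max].
Proof.
have off (k : 'I_m.+2) :
    reshape_offset [:: m.+1; 1%N] k = if k == ord_max then 0%N else k.
  rewrite /reshape_offset /reshape_index /= subn_eq0 -val_eqE /=.
  have := ltn_ord k; rewrite ltnS leq_eqVlt => /orP[/eqP->|lt_k].
    by rewrite ltnn eqxx subSnn /= addn0 subnn.
  by rewrite lt_k ltn_eqF // subn0.
have off0 k : k != ord0 -> k != ord_max ->
    forall l : 'I_m.+2,
      reshape_offset [:: m.+1; 1%N] l = reshape_offset [:: m.+1; 1%N] k -> l = k.
  move=> k0 kmax l; rewrite !off (negbTE kmax); case: eqP => _ lk.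
    by case/eqP: k0; apply: val_inj.
  exact: val_inj.
apply/setP=> q; rewrite !inE; apply/forallP/orP => [qP|].
  have qfix k : k != ord0 -> k != ord_max -> q k = k.
    by move=> k0 kmax; apply: off0 => //; apply/eqP.
  have [q0|q0] := eqVneq (q ord0) ord0.
    left; apply/eqP/permP=> k; rewrite perm1.
    have [->//|k0] := eqVneq k ord0.
    have [->|] := eqVneq k ord_max; last exact: qfix.
    apply/eqP/negP=> /negP qm; have := qfix (q ord_max).
    rewrite qm -[ord0 in _ != ord0]q0 (inj_eq perm_inj) => /(_ isT isT)/perm_inj e.
    by rewrite e eqxx in qm.
  right; have qm : q ord0 = ord_max.
    apply/eqP/negP=> /negP qm; have /perm_inj e := qfix _ q0 qm.
    by rewrite e eqxx in q0.
  apply/eqP/permP=> k; case: tpermP => [->//|->|/eqP k0 /eqP km]; last exact: qfix.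
  have qmax : q ord_max != ord_max by rewrite -{2}qm (inj_eq perm_inj).
  apply/eqP/negP=> /negP q1; have /perm_inj e := qfix _ q1 qmax.
  by rewrite e eqxx in qmax.
case=> /eqP-> k; rewrite ?perm1 //; case: tpermP => [->|->|//].
  by rewrite !off eqxx.
by rewrite !off eqxx.
Qed.

Lemma specht_char_hook (m : nat) (x : 'S_m.+2) :
  specht_char m.+2 [:: m.+1; 1%N] x = #|[set i | x i == i]|%:R - 1.
Proof.
rewrite cfunE inE mulr1n /specht_repr.
move: (cyclic_mx_module _ _); set U := cyclic_mx _ _ => Umod.
pose w (i : 'I_m.+2) (y : 'S_m.+2) : algC := (y ord_max == i)%:R - (y ord0 == i)%:R.
pose V : 'M[algC]_(m.+2, #|[set: 'S_m.+2]|) := \matrix_(i, k) w i (enum_val k).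
have VE i (y : 'S_m.+2) : V i (gring_index [set: 'S_m.+2] y) = w i y.
  by rewrite mxE gring_indexK ?inE.
have Vs y : y \in [set: 'S_m.+2] ->
    V *m regular_repr algC [set: 'S_m.+2] y = perm_mx y *m V.
  by move=> Gy; apply: mulmx_regular => // i z; rewrite /w !permM !(inj_eq perm_inj).
have ne_0m : ord_max != ord0 :> 'I_m.+2 by [].
(* At [g], the identity contributes [g ord_max == ord_max], and the transposition contributes
   [g ord0 == ord_max] with sign -1. *)
have eV : young_symmetrizer m.+2 [:: m.+1; 1%N] = row ord_max V.
  apply/rowP=> k; rewrite young_symmetrizerE !mxE col_stab_hook.
  rewrite big_setU1 ?big_set1 /=; last first.
    rewrite inE; apply/eqP=> /permP/(_ ord0); rewrite perm1 tpermL => e.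
    by rewrite e eqxx in ne_0m.
  rewrite !row_stab_hook odd_perm1 odd_tperm (eq_sym ord0) ne_0m invg1 mul1g tpermV.
  by rewrite permM tpermR mul1r mulN1r.
have defU : (U :=: V)%MS.
  rewrite /U eV; apply: (cyclic_mx_row (s := id)) => // i.
  by exists (tperm ord_max i); rewrite ?inE // tpermL.
have [//||Q [QV Qker ->]] := mxtrace_submod Umod _ defU (Vs x _); rewrite ?inE //.
have Vsum : const_mx 1 *m V = 0 :> 'rV_ _.
  apply/rowP=> k; rewrite !mxE; under eq_bigr do rewrite !mxE mul1r /w.
  rewrite sumrB; apply/eqP; rewrite subr_eq0; apply/eqP.
  have sum1 j : \sum_(i < m.+2) (j == i)%:R = 1 :> algC.
    by rewrite (bigD1 j) //= eqxx big1 ?addr0 // => i /negbTE; rewrite eq_sym => ->.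
  by rewrite !sum1.
(* Up to scaling, [Vsum] is the only relation among the rows: the coefficient of [c *m V] at a [y]
   sending [ord_max] to [i] and [ord0] to [j] is [c 0 i - c 0 j]. *)
have kerV (c : 'rV_m.+2) i j : c *m V = 0 -> c 0 i = c 0 j.
  move=> cV0; have [->//|ne_ij] := eqVneq i j.
  have [y [yi yj]] : exists y : 'S_m.+2, y ord_max = i /\ y ord0 = j.
    (* The first factor sends [ord_max] to [i]; the second corrects the image of [ord0] to [j]
       without moving [i]. *)
    exists (tperm ord_max i * tperm (tperm ord_max i ord0) j)%g.
    rewrite !permM tpermL; split; last by rewrite tpermL.
    have ne0i : tperm ord_max i ord0 != i.
      by rewrite -[X in _ != X](tpermL ord_max i) (inj_eq perm_inj).
    by rewrite (tpermD ne0i) // eq_sym.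
  have := congr1 (fun A : 'M_(_, _) => A 0 (gring_index _ y)) cV0.
  rewrite !mxE; under eq_bigr do rewrite VE /w mulrBr.
  have pick a : \sum_k c 0 k * (a == k)%:R = c 0 a.
    rewrite (bigD1 a) //= eqxx mulr1 big1 ?addr0 // => k /negbTE.
    by rewrite eq_sym => ->; rewrite mulr0.
  by rewrite sumrB !pick yi yj => /eqP; rewrite subr_eq0 => /eqP.
(* The rows of [D] are relations, hence constant, so [Q] is the identity plus a matrix with constant
   rows. As [Q] kills the all-ones relation, these constants sum to -1. *)
pose D := Q - 1%:M.
have DV : D *m V = 0 by rewrite mulmxBl QV mul1mx subrr.
have Dc a i j : D a i = D a j.
  have := @kerV (row a D) i j; rewrite -row_mul DV row0 !mxE; exact.
have QE a b : Q a b = (a == b)%:R + D a a.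
  have -> : D a a = Q a b - (a == b)%:R by rewrite (Dc a a b) /D !mxE.
  by rewrite addrC subrK.
have sumD : \sum_i D i i = -1.
  have := congr1 (fun A : 'M_(_, _) => A 0 ord0) (Qker _ Vsum).
  rewrite !mxE; under eq_bigr do rewrite mxE mul1r QE.
  rewrite big_split /= (bigD1 ord0) //= big1 ?addr0 => [|i /negbTE->//].
  by move=> /eqP; rewrite addrC addr_eq0 => /eqP.
(* The trace is the sum of [Q (x i) i]: the identity part counts fixed points, and the constants
   [D (x i) (x i)] run over all of the diagonal of [D]. *)
rewrite -row_permE /mxtrace; under eq_bigr do rewrite mxE QE.
rewrite big_split /= -sumD; congr (_ + _).
  rewrite -sum1dep_card natr_sum [RHS]big_mkcond; apply: eq_bigr => i _.
  by case: (x i == i).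
by rewrite [RHS](reindex_inj (@perm_inj _ x)).
Qed.

(** * Means of the excedance statistics over conjugacy classes *)

Lemma card_set_sum (T : finType) (P : pred T) : #|[set i | P i]| = (\sum_i P i)%N.
Proof. by rewrite -sum1dep_card big_mkcond; apply: eq_bigr => i _; case: (P i). Qed.

Lemma card_fixed_conj (n : nat) (x g : 'S_n) :
  #|[set i | (x ^ g)%g i == i]| = #|[set i | x i == i]|.
Proof.
rewrite !card_set_sum (reindex_inj (@perm_inj _ g)); apply: eq_bigr => i _.
by rewrite permJ (inj_eq perm_inj).
Qed.

Lemma exc_conj_rev (n : nat) (y : 'S_n) :
  exc (y ^ perm (@rev_ord_inj n))%g = #|[set i : 'I_n | (y i < i)%N]|.
Proof.
rewrite /exc !card_set_sum (reindex_inj (@perm_inj _ (perm (@rev_ord_inj n)))).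
apply: eq_bigr => i _; rewrite permJ !permE /=.
by rewrite ltn_sub2lE ?ltnS.
Qed.

Lemma card_trichotomy (n : nat) (y : 'S_n) :
  (exc y + #|[set i : 'I_n | y i < i]| + #|[set i | y i == i]| = n)%N.
Proof.
rewrite /exc !card_set_sum -!big_split /= -[RHS]card_ord -sum1_card.
by apply: eq_bigr => i _; rewrite -val_eqE /=; case: ltngtP.
Qed.

Lemma wexc_exc (n : nat) (y : 'S_n) :
  wexc y = (exc y + #|[set i | y i == i]|)%N.
Proof.
rewrite /wexc /exc !card_set_sum -big_split; apply: eq_bigr => i _.
by rewrite -val_eqE /=; case: ltngtP.
Qed.

Lemma sum_exc_class (n : nat) (x : 'S_n) :
  (2 * (\sum_(y in x ^: [set: 'S_n]) exc y)
      + #|x ^: [set: 'S_n]| * #|[set i | x i == i]| = #|x ^: [set: 'S_n]| * n)%N.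
Proof.
set C := x ^: _; rewrite mul2n -addnn.
(* One of the two copies of the sum is reindexed by conjugation with the reversal, which preserves
   the class; it then counts anti-excedances, and the trichotomy applies to each [y] separately. *)
rewrite [X in (_ + X + _)%N](reindex_inj (conjg_inj (perm (@rev_ord_inj n)))) /=.
rewrite [X in (_ + X + _)%N](eq_bigl (mem C)) => [|y]; last first.
  by rewrite memJ_norm // (subsetP (class_norm x _)) ?inE.
rewrite -!sum_nat_const -!big_split; apply: eq_bigr => y /imsetP[g _ ->] /=.
by rewrite exc_conj_rev -(card_fixed_conj x g) card_trichotomy.
Qed.

Lemma card_class_neq0 (n : nat) (x : 'S_n) :
  #|x ^: [set: 'S_n]|%:R != 0 :> algC.
Proof. by rewrite pnatr_eq0 -lt0n (cardD1 x) class_refl. Qed.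

Lemma mean_exc (n : nat) (x : 'S_n) :
  mean (fun p : 'S_n => (exc p)%:R) x = (n%:R - #|[set i | x i == i]|%:R) / 2%:R.
Proof.
rewrite cfunE /mean_fun -natr_sum.
have C0 := card_class_neq0 x.
have /(congr1 (fun k : nat => k%:R : algC)) := sum_exc_class x.
rewrite natrD !natrM => e; apply: (mulfI C0); rewrite mulVKf //.
apply: (@mulfI _ 2%:R); first by rewrite pnatr_eq0.
rewrite [RHS]mulrCA [2%:R * (_ / _)]mulrC mulfVK ?pnatr_eq0 //.
by rewrite mulrBr -e addrK.
Qed.

Lemma mean_wexc (n : nat) (x : 'S_n) :
  mean (fun p : 'S_n => (wexc p)%:R) x = (n%:R + #|[set i | x i == i]|%:R) / 2%:R.
Proof.
have C0 := card_class_neq0 x.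
(* The number of fixed points is constant on the class, so averaging leaves it unchanged. *)
have -> : mean (fun p : 'S_n => (wexc p)%:R) x
    = mean (fun p : 'S_n => (exc p)%:R) x + #|[set i | x i == i]|%:R.
  rewrite !cfunE /mean_fun -[X in _ = _ + X](mulKf C0) -mulrDr; congr (_ * _).
  rewrite -natrM -sum_nat_const natr_sum -big_split; apply: eq_bigr.
  by move=> y /imsetP[g _ ->] /=; rewrite wexc_exc natrD card_fixed_conj.
by rewrite mean_exc; field.
Qed.

Theorem theorem5p1 (n : nat) (hn : (2 <= n)%N) :
  mean (fun p : 'S_n => (exc p)%:R) =
    ((n%:R - 1) / 2%:R) *: specht_char n [:: n]
      - (1 / 2%:R) *: specht_char n [:: n.-1; 1%N]
  /\
  mean (fun p : 'S_n => (wexc p)%:R) =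
    ((n%:R + 1) / 2%:R) *: specht_char n [:: n]
      + (1 / 2%:R) *: specht_char n [:: n.-1; 1%N].
Proof.
case: n hn => [|[|m]] // _.
have := @specht_char_hook m; have := @specht_char_row m.+2.
move: (specht_char _ _) (specht_char _ _) => chi1 chi2 chi1E chi2E.
(* With F fixed points, (n-1)/2 - (F-1)/2 = (n-F)/2 and (n+1)/2 + (F-1)/2 = (n+F)/2. *)
split; apply/cfunP=> x; rewrite ?mean_exc ?mean_wexc !cfunE chi1E chi2E.
  by field.
by field.
Qed.
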